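(* Let $\mathbb{K}\in\{\mathbb{K}_c,\mathbb{K}_v,\mathbb{K}_o,\mathbb{K}_s,\mathbb{K}_d\}$, let $f,F_{1,i},F_{2,i}:\mathbb{R}^n\to\mathbb{R}$, $i=1,\ldots,m$, be twice continuously differentiable, let $M=\{x\in\mathbb{R}^n \mid (F_{1,i}(x),F_{2,i}(x))\in\mathbb{K},\ i=1,\ldots,m\}$, and let $\bar x\in M$ satisfy SNO-LICQ and $F_{1,i}(\bar x)=F_{2,i}(\bar x)=0$ for all $i=1,\ldots,m$. Then, for the problem $\min_x f(x)$ s.t. $x\in M$, the following implications hold at $\bar x$: $$\widehat N\text{-stationarity}\ \Longrightarrow\ N\text{-stationarity}\ \Longrightarrow\ \text{T-stationarity}\ \Longrightarrow\ \overline N\text{-stationarity}.$$ Moreover, none of the converse implications is true in general: for each of these three implications there exist a choice of $\mathbb{K}$ among the five cones $\mathbb{K}_c,\mathbb{K}_v,\mathbb{K}_o,\mathbb{K}_s,\mathbb{K}_d$, of data $n,m$ and twice continuously differentiable $f,F_{1,i},F_{2,i}:\mathbb{R}^n\to\mathbb{R}$, $i=1,\ldots,m$, and of a point $\bar x\in M=\{x\in\mathbb{R}^n \mid (F_{1,i}(x),F_{2,i}(x))\in\mathbb{K},\ i=1,\ldots,m\}$ satisfying SNO-LICQ and $F_{1,i}(\bar x)=F_{2,i}(\bar x)=0$ for all $i=1,\ldots,m$, such that $\bar x$ satisfies the conclusion but not the premise of that implication.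
   Context: Cones in $\mathbb{R}^2$: $\mathbb{K}_c=\{(a_1,a_2)\mid a_1a_2=0,\ a_1\ge 0,\ a_2\ge 0\}$ (complementarity, MPCC); $\mathbb{K}_v=\{(a_1,a_2)\mid a_1\ge 0,\ a_1a_2\le 0\}$ (vanishing, MPVC); $\mathbb{K}_o=\{(a_1,a_2)\mid a_1a_2=0,\ a_2\ge 0\}$ (orthogonality type, MPOC); $\mathbb{K}_s=\{(a_1,a_2)\mid a_1a_2=0\}$ (switching, MPSC); $\mathbb{K}_d=\{(a_1,a_2)\mid a_1\ge 0\text{ or }a_2\ge 0\}$ (disjunctive, MPDC). The problem SNO is: minimize $f(x)$ subject to $x\in M$. SNO-LICQ at $\bar x\in M$: the vectors $\nabla F_{1,i}(\bar x)$ for $i\in\{1,\ldots,m\}$ with $F_{1,i}(\bar x)=0$, together with $\nabla F_{2,i}(\bar x)$ for $i\in\{1,\ldots,m\}$ with $F_{2,i}(\bar x)=0$, are linearly independent. Biactive index set: $I_{00}(\bar x)=\{i\in\{1,\ldots,m\}\mid F_{1,i}(\bar x)=0,\ F_{2,i}(\bar x)=0\}$; it is assumed throughout that $I_{00}(\bar x)=\{1,\ldots,m\}$. Normal cones to $M$ at $\bar x\in M$. The tangential cone $T_M(\bar x)$ consists of all $w$ for which there exist $x^k\to\bar x$ with $x^k\in M$ and $\tau^k\searrow 0$ such that $(x^k-\bar x)/\tau^k\to w$. The Fréchet normal cone is $\widehat N_M(\bar x)=\{v\mid \langle v,w\rangle\le 0\text{ for all }w\in T_M(\bar x)\}$. The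 Mordukhovich (limiting) normal cone $N_M(\bar x)$ consists of all $v$ for which there exist $x^k\to\bar x$ with $x^k\in M$ and $v^k\in\widehat N_M(x^k)$ with $v^k\to v$. The Clarke normal cone $\overline N_M(\bar x)$ is the closure of the convex hull of $N_M(\bar x)$. The point $\bar x\in M$ is called $\widehat N$-stationary if $0\in\nabla f(\bar x)+\widehat N_M(\bar x)$, $N$-stationary if $0\in\nabla f(\bar x)+N_M(\bar x)$, and $\overline N$-stationary if $0\in\nabla f(\bar x)+\overline N_M(\bar x)$. The point $\bar x\in M$ is called T-stationary if there are multipliers $\lambda_{1,i},\lambda_{2,i}\in\mathbb{R}$, $i\in I_{00}(\bar x)$, with $$\nabla f(\bar x)=\sum_{i\in I_{00}(\bar x)}\bigl(\lambda_{1,i}\nabla F_{1,i}(\bar x)+\lambda_{2,i}\nabla F_{2,i}(\bar x)\bigr)$$ such that for all $i\in I_{00}(\bar x)$: if $\mathbb{K}=\mathbb{K}_c$: $\lambda_{1,i}\lambda_{2,i}\ge 0$; if $\mathbb{K}=\mathbb{K}_v$: $\lambda_{1,i}\lambda_{2,i}\ge 0$ and $\lambda_{2,i}\le 0$; if $\mathbb{K}=\mathbb{K}_o$: $\lambda_{1,i}=0$ or $\lambda_{2,i}\le 0$; if $\mathbb{K}=\mathbb{K}_s$: no restriction; if $\mathbb{K}=\mathbb{K}_d$: $\lambda_{1,i}\ge 0$ and $\lambda_{2,i}\ge 0$. *)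

(* Defs.v *)
(* MathComp / MathComp-Analysis development; R^n is 'rV[R]_n. *)
From mathcomp Require Import all_boot all_order all_algebra.
From mathcomp Require Import all_classical all_reals all_analysis.
Import Order.TTheory GRing.Theory Num.Theory.
Import numFieldNormedType.Exports.

Set Implicit Arguments.
Unset Strict Implicit.
Unset Printing Implicit Defensive.

Local Open Scope classical_set_scope.
Local Open Scope ring_scope.

Section Calculus.
Context {R : realType} {n : nat}.
Implicit Types (f : 'rV[R]_n -> R) (x u v : 'rV[R]_n).

Definition dotp u v : R := (u *m v^T) 0 0.

Definition grad f x : 'rV[R]_n := \row_(j < n) 'D_(delta_mx 0 j) f x.

(* Frechet differentiability of f and of its gradient, with continuous Hessian
   'J (grad f) x. *)
Definition C2 f : Prop :=
  [/\ forall x, differentiable f x,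
      forall x, differentiable (grad f) x &
      continuous (fun x => 'J (grad f) x)].

End Calculus.

Section NormalCones.
Context {R : realType} {n : nat}.
Implicit Types (M : set 'rV[R]_n) (x : 'rV[R]_n).

(* Only positivity of the step sizes is required; passing to a subsequence,
   they may also be taken decreasing. *)
Definition tangent_cone M x : set 'rV[R]_n :=
  [set w | exists (xs : nat -> 'rV[R]_n) (t : nat -> R),
    [/\ forall k, M (xs k),
        xs @ \oo --> x,
        forall k, 0 < t k,
        t @ \oo --> (0 : R) &
        (fun k => (t k)^-1 *: (xs k - x)) @ \oo --> w]].

Definition frechet_normal_cone M x : set 'rV[R]_n :=
  [set v | forall w, tangent_cone M x w -> dotp v w <= 0].

Definition limiting_normal_cone M x : set 'rV[R]_n :=
  [set v | exists xs vs : nat -> 'rV[R]_n,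
    [/\ forall k, M (xs k),
        xs @ \oo --> x,
        forall k, frechet_normal_cone M (xs k) (vs k) &
        vs @ \oo --> v]].

Definition convex_hull (A : set 'rV[R]_n) : set 'rV[R]_n :=
  smallest (@convex_set R 'rV[R]_n) A.

Definition clarke_normal_cone M x : set 'rV[R]_n :=
  closure (convex_hull (limiting_normal_cone M x)).

Definition stationary_wrt (N : set 'rV[R]_n -> 'rV[R]_n -> set 'rV[R]_n)
    (f : 'rV[R]_n -> R) M x : Prop :=
  [set grad f x + v | v in N M x] 0.

End NormalCones.

(* Complementarity, vanishing, orthogonality, switching, disjunctive. *)
Inductive cone_type := Kc | Kv | Ko | Ks | Kd.

Definition cone {R : realType} (K : cone_type) : set (R * R) :=
  match K with
  | Kc => [set a | [/\ a.1 * a.2 = 0, 0 <= a.1 & 0 <= a.2]]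
  | Kv => [set a | 0 <= a.1 /\ a.1 * a.2 <= 0]
  | Ko => [set a | a.1 * a.2 = 0 /\ 0 <= a.2]
  | Ks => [set a | a.1 * a.2 = 0]
  | Kd => [set a | 0 <= a.1 \/ 0 <= a.2]
  end.

Definition multiplier_sign {R : realType} (K : cone_type) (l1 l2 : R) : Prop :=
  match K with
  | Kc => 0 <= l1 * l2
  | Kv => 0 <= l1 * l2 /\ l2 <= 0
  | Ko => l1 = 0 \/ l2 <= 0
  | Ks => True
  | Kd => 0 <= l1 /\ 0 <= l2
  end.

Section SNO.
Context {R : realType} (K : cone_type) {n m : nat}.
Context (f : 'rV[R]_n -> R) (F1 F2 : 'I_m -> 'rV[R]_n -> R).

Definition feasible_set : set 'rV[R]_n :=
  [set x | forall i, cone K (F1 i x, F2 i x)].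

(* The active gradients are listed as a family, so repeated vectors make it
   dependent. *)
Definition SNO_LICQ (x : 'rV[R]_n) : Prop :=
  free ([seq grad (F1 i) x | i <- enum 'I_m & F1 i x == 0] ++
        [seq grad (F2 i) x | i <- enum 'I_m & F2 i x == 0]).

Definition biactive (x : 'rV[R]_n) : {set 'I_m} :=
  [set i | (F1 i x == 0) && (F2 i x == 0)].

Definition T_stationary (x : 'rV[R]_n) : Prop :=
  exists l1 l2 : 'I_m -> R,
    grad f x = \sum_(i in biactive x)
                 (l1 i *: grad (F1 i) x + l2 i *: grad (F2 i) x) /\
    forall i, i \in biactive x -> multiplier_sign K (l1 i) (l2 i).

Definition SNO_setting (x : 'rV[R]_n) : Prop :=
  [/\ C2 f,
      forall i, C2 (F1 i) /\ C2 (F2 i),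
      feasible_set x,
      SNO_LICQ x &
      forall i, F1 i x = 0 /\ F2 i x = 0].

Definition hatN_stationary := stationary_wrt frechet_normal_cone f feasible_set.
Definition N_stationary := stationary_wrt limiting_normal_cone f feasible_set.
Definition barN_stationary := stationary_wrt clarke_normal_cone f feasible_set.

End SNO.

(* Main.v *)
From HB Require Import structures.
Require Import Defs.
From mathcomp Require Import all_boot all_order all_algebra.
From mathcomp Require Import all_classical all_reals all_analysis.
Import Order.TTheory GRing.Theory Num.Theory.
From mathcomp Require Import ring lra.
Import numFieldNormedType.Exports.

Set Implicit Arguments.
Unset Strict Implicit.
Unset Printing Implicit Defensive.

Local Open Scope classical_set_scope.
Local Open Scope ring_scope.

(** Write g = (F1, F2) : R^n -> R^(2m) and let S be the product of m copies of
    the planar cone, so that the feasible set M is the preimage of S under g.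
    Under SNO-LICQ the Jacobian of g at the biactive point x is onto, and it
    stays onto at nearby points; the normals to M are then pulled back from the
    normals to S.

    The step that makes this rigorous is an open mapping theorem with velocity
    control (strict_open_mapping): for each w and all small t > 0 there is u
    close to w with g(x + t u) = g(x) + t Dg(x) w exactly. It follows from the
    contraction principle. The points x + t u give tangent vectors of M
    (tangent_preimage), and they also give feasible points near x at which a
    chosen coordinate of g is nonzero and all others vanish.

    A Frechet normal at x is a limiting normal, by constant sequences.

    N-stationary implies T-stationary. At a feasible point y near x a Frechet
    normal is orthogonal to the kernel of Dg(y), hence a combination of the
    gradients, and the multipliers are polar to all directions along which
    a short segment from g(y) stays in S. For each of the five planar cones, the
    polarity against the coordinate directions alone already forces the sign
    condition of T-stationarity (axis_polar_sign). That condition is closed, and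
    the multipliers converge along with the normals because Dg stays onto
    (limiting_normal_multiplier).

    T-stationary implies Clarke stationary. Given multipliers with the right
    signs, each single term of the combination is a limiting normal: move to a
    point where only the partner of the constraint in question is nonzero; there
    the constraint function has a constant sign on M, or vanishes, and its
    gradient is a Frechet normal (frechet_normal_grad, sign_axis_normal). The
    limiting normal cone is a cone, so its convex hull is closed under sums.

    The three strict inclusions are already seen in the plane, with F1 and F2
    the coordinates, x = 0 and f linear. For the switching cone, the union of
    the axes, the Frechet, limiting and T normals at 0 are respectively 0, the
    union of the axes and the plane. For the complementarity cone the T normals
    are the first and third quadrants, whose convex hull is the plane. *)

(** * Norms and limits of matrices *)

(* Joins completeness with the norm, as the contraction principle requires. *)
HB.instance Definition _ (R : realType) m n := Complete.on (matrix R m n).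

Section MatrixNorm.
Context {R : realType}.

Lemma coord_le_norm m n (A : 'M[R]_(m, n)) i j : `|A i j| <= `|A|.
Proof.
rewrite [leRHS]/Num.Def.normr/= mx_normrE.
exact: (le_bigmax _ (fun ij : 'I_m * 'I_n => `|A ij.1 ij.2|) (i, j)).
Qed.

Lemma mx_norm_le m n (A : 'M[R]_(m, n)) e :
  0 <= e -> (forall i j, `|A i j| <= e) -> `|A| <= e.
Proof.
move=> e0 Ae; rewrite [leLHS]/Num.Def.normr/= mx_normrE.
by apply: bigmax_le => // -[i j] _; exact: Ae.
Qed.

Lemma mx_norm_mul m n p (A : 'M[R]_(m, n)) (B : 'M[R]_(n, p)) :
  `|A *m B| <= n%:R * `|A| * `|B|.
Proof.
apply: mx_norm_le => [|i j]; first by rewrite !mulr_ge0.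
rewrite mxE (le_trans (ler_norm_sum _ _ _))//.
rewrite (@le_trans _ _ (\sum_(k < n) `|A| * `|B|))//.
  by apply: ler_sum => k _; rewrite normrM ler_pM// coord_le_norm.
by rewrite sumr_const card_ord -mulrA mulr_natl.
Qed.

Lemma cvg_mx_coord T (F : set_system T) {FF : Filter F} m n
    (u : T -> 'M[R]_(m, n)) (A : 'M[R]_(m, n)) :
  (forall i j, (fun k => u k i j) @ F --> A i j) -> u @ F --> A.
Proof.
move=> uA; apply/cvgrPdist_le => e e0; near=> k.
apply: mx_norm_le => [|i j]; first exact: ltW.
rewrite !mxE; move: i j; near: k.
apply: filter_forall => i; apply: filter_forall => j.
by move/cvgrPdist_le : (uA i j); exact.
Unshelve. all: by end_near. Qed.

Lemma mulmx_cvg T (F : set_system T) {FF : Filter F} m n p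
    (u : T -> 'M[R]_(m, n)) (A : 'M[R]_(m, n))
    (v : T -> 'M[R]_(n, p)) (B : 'M[R]_(n, p)) :
  u @ F --> A -> v @ F --> B -> (fun k => u k *m v k) @ F --> A *m B.
Proof.
move=> uA vB; apply: cvg_mx_coord => i j; rewrite mxE.
under eq_fun do rewrite mxE.
apply: cvg_big => [|k _]; first exact: add_continuous.
apply: cvgM.
  by apply: (@cvg_comp _ _ _ u (fun M : 'M[R]_(m, n) => M i k)) uA _; exact: coord_continuous.
by apply: (@cvg_comp _ _ _ v (fun M : 'M[R]_(n, p) => M k j)) vB _; exact: coord_continuous.
Qed.

(** A Neumann-series bound without the series. It serves twice for Jacobians near
    that of the base point: it shows that they have independent rows, and it
    bounds the multipliers uniformly. *)
Lemma norm_le_mulmx_near1 p (N : 'M[R]_p) (eta : 'rV_p) :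
  p%:R * `|1%:M - N| <= 2^-1 -> `|eta| <= 2 * `|eta *m N|.
Proof.
move=> pN; have : `|eta - eta *m N| <= 2^-1 * `|eta|.
  rewrite -{1}[eta]mulmx1 -mulmxBr (le_trans (mx_norm_mul _ _))//.
  by rewrite mulrAC ler_wpM2r.
have := ler_normD (eta *m N) (eta - eta *m N); rewrite addrC subrK.
by move=> h1 h2; lra.
Qed.

End MatrixNorm.

(** * Gradients and strict differentiability *)

Section Gradient.
Context {R : realType} {n : nat}.
Implicit Types (f : 'rV[R]_n -> R) (x a b v : 'rV[R]_n).

Lemma dotpE (u v : 'rV[R]_n) : dotp u v = \sum_(j < n) u 0 j * v 0 j.
Proof. by rewrite /dotp mxE; apply: eq_bigr => j _; rewrite mxE. Qed.

Lemma diff_dotp_grad f x v : differentiable f x -> 'd f x v = dotp (grad f x) v.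
Proof.
move=> df; rewrite {1}(row_sum_delta v) linear_sum dotpE; apply: eq_bigr => j _.
by rewrite linearZ mxE deriveE// mulrC.
Qed.

Lemma dotp_norm_le (u v : 'rV[R]_n) : `|dotp u v| <= n%:R * `|u| * `|v|.
Proof.
rewrite dotpE (le_trans (ler_norm_sum _ _ _))//.
rewrite (@le_trans _ _ (\sum_(k < n) `|u| * `|v|))//.
  by apply: ler_sum => k _; rewrite normrM ler_pM// coord_le_norm.
by rewrite sumr_const card_ord -mulrA mulr_natl.
Qed.

Lemma mean_value f a b : (forall x, differentiable f x) ->
  exists2 s, 0 <= s <= 1 & f a - f b = dotp (grad f (b + s *: (a - b))) (a - b).
Proof.
move=> df; pose g (s : R) := b + s *: (a - b).
have dg (s : R) : is_diff s g ( *:%R^~ (a - b)).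
  by apply: is_diff_eq => /=; rewrite funeqE => t /=; rewrite add0r.
have dfg (s : R) : is_derive s 1 (f \o g) (dotp (grad f (g s)) (a - b)).
  have dgs : differentiable g s by [].
  have dc : differentiable (f \o g) s by apply: differentiable_comp.
  apply: DeriveDef; first exact: diff_derivable.
  by rewrite deriveE// diff_comp//= diff_val scale1r diff_dotp_grad.
have [|s s01] := @MVT_segment R (f \o g) _ 0 1 ler01 (fun s _ => dfg s).
  apply: continuous_subspaceT => s.
  by apply: differentiable_continuous; exact/derivable1_diffP.
rewrite /g /= scale1r scale0r addr0 subr0 mulr1 [b + (a - b)]addrC subrK => ->.
by exists s => //; rewrite in_itv/= in s01.
Qed.

(** The mean value theorem writes the increment through a gradient on the segment
    from b to a, and that gradient is close to the one at x. Moving both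
    endpoints is what the contraction argument below needs. *)
Lemma strict_diff f x e : (forall x, differentiable f x) ->
  {for x, continuous (grad f)} -> 0 < e ->
  exists2 d, 0 < d & forall a b, `|a - x| < d -> `|b - x| < d ->
    `|f a - f b - dotp (grad f x) (a - b)| <= e * `|a - b|.
Proof.
move=> df cf e0; have K0 : 0 < n%:R + 1 :> R by rewrite ltr_wpDl.
move/cvgrPdist_lt : cf => /(_ (e / (n%:R + 1))).
rewrite divr_gt0// => /(_ isT) /nbhs_ballP[d d0 xd].
exists d => // a b xa xb; have [s /andP[s0 s1] ->] := mean_value a b df.
set y := b + _.
have -> : dotp (grad f y) (a - b) - dotp (grad f x) (a - b) =
          dotp (grad f y - grad f x) (a - b).
  by rewrite /dotp mulmxBl !mxE.
have /ltW : `|grad f x - grad f y| < e / (n%:R + 1).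
  apply: xd; rewrite -ball_normE/= distrC.
  have -> : y - x = s *: (a - x) + (1 - s) *: (b - x).
    by apply/rowP => j; rewrite /y !mxE; ring.
  rewrite (le_lt_trans (ler_normD _ _))// !normrZ !ger0_norm ?subr_ge0//.
  have [->|sn0] := eqVneq s 0; first by rewrite mul0r add0r subr0 mul1r.
  have sgt0 : 0 < s by rewrite lt_def sn0.
  rewrite [ltRHS](_ : _ = s * d + (1 - s) * d); last by ring.
  by rewrite ltr_leD// ?ltr_pM2l// ler_wpM2l ?subr_ge0// ltW.
rewrite distrC ler_pdivlMr// => h.
rewrite (le_trans (dotp_norm_le _ _))// ler_wpM2r//.
by rewrite (le_trans _ h)// mulrC ler_wpM2l// lerDl.
Qed.

End Gradient.

(** * Local surjectivity with velocity control *)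

Section OpenMapping.
Context {R : realType} {n p : nat}.

(** The unknown is sought as u = w + q C, where C is a right inverse of the
    derivative in row-vector convention. The Newton-type map H below, which
    fixes q exactly when G (x + t u) = G x + t (w A), has increments equal to
    - 1 / t times the error of strict differentiability; hence it contracts a
    ball of fixed radius r as soon as t is small. *)
Lemma strict_open_mapping (G : 'rV[R]_n -> 'rV[R]_p) x
    (A : 'M[R]_(n, p)) (C : 'M[R]_(p, n)) :
  (forall e, 0 < e -> exists2 d, 0 < d & forall a b,
     `|a - x| < d -> `|b - x| < d ->
     `|G a - G b - (a - b) *m A| <= e * `|a - b|) ->
  C *m A = 1%:M ->
  forall w e, 0 < e -> exists2 d, 0 < d & forall t, 0 < t < d ->
    exists2 u, `|u - w| <= e & G (x + t *: u) = G x + t *: (w *m A).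
Proof.
move=> dG CA w e e0.
pose K := p%:R * `|C| + 1.
have K0 : 0 < K by rewrite ltr_wpDl// mulr_ge0.
have KC (q : 'rV[R]_p) : `|q *m C| <= K * `|q|.
  rewrite (le_trans (mx_norm_mul _ _))// mulrAC ler_wpM2r//.
  by rewrite lerDl.
pose r := e / K.
have r0 : 0 < r by rewrite divr_gt0.
have we0 : 0 < `|w| + e by rewrite ltr_wpDl.
(* The first bound makes H contract by 1/2, the second keeps the ball stable. *)
pose e' := Num.min (2^-1 / K) (r / (`|w| + e)).
have e'0 : 0 < e' by rewrite lt_min !divr_gt0.
have [d d0 dE] := dG e' e'0.
exists (d / (`|w| + e)); first exact: divr_gt0.
move=> t /andP[t0]; rewrite ltr_pdivlMr// => td.
pose u q := w + q *m C.
pose H q := q - t^-1 *: (G (x + t *: u q) - G x - t *: (w *m A)).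
pose U := [set q : 'rV[R]_p | `|q| <= r].
have uw q : U q -> `|u q - w| <= e.
  rewrite /U/= /u addrC addKr => qr; rewrite (le_trans (KC _))//.
  by rewrite -ler_pdivlMl// mulrC.
have un q : U q -> `|u q| <= `|w| + e.
  move=> /uw h; rewrite -(subrK w (u q)) (le_trans (ler_normD _ _))//.
  by rewrite addrC lerD2l.
have ud q : U q -> `|x + t *: u q - x| < d.
  move=> /un h; rewrite addrC addKr normrZ gtr0_norm// (le_lt_trans _ td)//.
  by rewrite ler_pM2l.
have HB q q' : U q -> U q' -> `|H q - H q'| <= 2^-1 * `|q - q'|.
  move=> Uq Uq'.
  have -> : H q - H q' = - t^-1 *: (G (x + t *: u q) - G (x + t *: u q') -
      (x + t *: u q - (x + t *: u q')) *m A).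
    have -> : (x + t *: u q - (x + t *: u q')) *m A = t *: (q - q').
      rewrite opprD addrACA subrr add0r -scalerBr -scalemxAl /u.
      by rewrite opprD addrACA subrr add0r -mulmxBl -mulmxA CA mulmx1.
    by apply/rowP => j; rewrite /H !mxE; field; rewrite gt_eqF.
  rewrite normrZ normrN gtr0_norm ?invr_gt0// ler_pdivrMl//.
  apply: (le_trans (dE _ _ (ud _ Uq) (ud _ Uq'))).
  have -> : x + t *: u q - (x + t *: u q') = t *: ((q - q') *m C).
    rewrite opprD addrACA subrr add0r -scalerBr /u.
    by rewrite opprD addrACA subrr add0r -mulmxBl.
  rewrite normrZ gtr0_norm// mulrCA ler_pM2l//.
  rewrite (le_trans (ler_wpM2l (ltW e'0) (KC _)))// mulrA ler_wpM2r//.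
  by rewrite -ler_pdivlMr// ge_min lexx.
have HU : {homo H : q / U q >-> U q}.
  move=> q Uq; rewrite /U/=.
  have -> : H q = - t^-1 *: (G (x + t *: u q) - G x - (x + t *: u q - x) *m A).
    have -> : (x + t *: u q - x) *m A = t *: (w *m A + q).
      by rewrite addrC addKr -scalemxAl /u mulmxDl -mulmxA CA mulmx1.
    by apply/rowP => j; rewrite /H !mxE; field; rewrite gt_eqF.
  rewrite normrZ normrN gtr0_norm ?invr_gt0// ler_pdivrMl//.
  have xd : `|x - x| < d by rewrite subrr normr0.
  apply: (le_trans (dE _ _ (ud _ Uq) xd)).
  rewrite addrC addKr normrZ gtr0_norm// mulrCA ler_pM2l//.
  rewrite (le_trans (ler_wpM2l (ltW e'0) (un _ Uq)))//.
  by rewrite -ler_pdivlMr// ge_min lexx orbT.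
have cU : closed U.
  rewrite (_ : U = closed_ball 0 r); first exact: closed_ball_closed.
  by rewrite closed_ballE// /U /closed_ball_; apply/seteqP; split => q /=;
    rewrite sub0r normrN.
have U0 : U !=set0 by exists 0; rewrite /U/= normr0 ltW.
have [] := @banach_fixed_point R 'rV[R]_p U (mkfun_fun HU) _ cU U0.
  have h0 : (0 : R) <= 2^-1 by rewrite invr_ge0.
  exists (NngNum h0); split; first by rewrite /=; lra.
  by move=> /= [q q'] [/= Uq Uq']; exact: HB.
move=> q Uq /= Hq; exists (u q); first exact: uw.
move/eqP: Hq; rewrite /H -subr_eq0 opprB addrC subrK scaler_eq0 invr_eq0.
rewrite gt_eqF//= subr_eq add0r subr_eq => /eqP ->.
by rewrite addrC.
Qed.

End OpenMapping.

Section Preimage.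
Context {R : realType} {n p : nat}.
Context (g : 'I_p -> 'rV[R]_n -> R).

Definition rowmap x : 'rV[R]_p := \row_j g j x.
Definition gradmx x : 'M[R]_(p, n) := \matrix_j grad (g j) x.

Context (dg : forall j x, differentiable (g j) x).
Context (cg : forall j, continuous (grad (g j))).

Lemma rowmap_continuous : continuous rowmap.
Proof.
move=> x; apply: (@cvg_mx_coord _ _ (nbhs x) _) => i j.
rewrite mxE; under eq_fun do rewrite mxE.
exact: differentiable_continuous.
Qed.

Lemma gradmx_continuous : continuous gradmx.
Proof.
move=> x; apply: (@cvg_mx_coord _ _ (nbhs x) _) => i j.
rewrite mxE; under eq_fun do rewrite mxE.
apply: (@cvg_comp _ _ _ (grad (g i)) (fun M : 'rV[R]_n => M 0 j)) (@cg i x) _.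
exact: coord_continuous.
Qed.

Lemma rowmap_strict_diff x e : 0 < e ->
  exists2 d, 0 < d & forall a b, `|a - x| < d -> `|b - x| < d ->
  `|rowmap a - rowmap b - (a - b) *m (gradmx x)^T| <= e * `|a - b|.
Proof.
move=> e0; pose P d j := forall a b, `|a - x| < d -> `|b - x| < d ->
   `|g j a - g j b - dotp (grad (g j) x) (a - b)| <= e * `|a - b|.
have nP j : \forall d \near 0^'+, P d j.
  have [d d0 dP] := strict_diff (dg j) (@cg j x) e0.
  near=> d' => a b ad bd.
  have dd : d' < d by near: d'; exact: nbhs_right_lt.
  by apply: dP; [apply: lt_trans dd|apply: lt_trans dd].
near (0 : R)^'+ => d; exists d => // a b ad bd.
have Pd : forall j, P d j by near: d; exact: filter_forall.
apply: mx_norm_le => [|i j]; first by rewrite mulr_ge0// ltW.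
rewrite ord1; apply: le_trans (Pd j a b ad bd); rewrite !mxE.
rewrite le_eqVlt; apply/orP; left; apply/eqP; congr `|_ - _|.
by rewrite dotpE; apply: eq_bigr => k _; rewrite !mxE mulrC.
Unshelve. all: by end_near. Qed.

(** The value of g moves exactly along a straight line while the points follow an
    arbitrary prescribed velocity; [tau] lets the caller keep the step sizes in
    the range where the line stays in the target set. *)
Lemma curve_with_velocity x (C : 'M[R]_(n, p)) w tau :
  gradmx x *m C = 1%:M -> 0 < tau ->
  exists (xs : nat -> 'rV[R]_n) (t : nat -> R),
    [/\ forall k, 0 < t k < tau,
        t @ \oo --> (0 : R),
        forall k, rowmap (xs k) = rowmap x + t k *: (w *m (gradmx x)^T),
        xs @ \oo --> x &
        (fun k => (t k)^-1 *: (xs k - x)) @ \oo --> w].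
Proof.
move=> GC tau0; have CG : C^T *m (gradmx x)^T = 1%:M by rewrite -trmx_mul GC trmx1.
have H k : exists tu : R * 'rV[R]_n, [/\ 0 < tu.1 < tau, tu.1 <= harmonic k,
    `|tu.2 - w| <= harmonic k &
    rowmap (x + tu.1 *: tu.2) = rowmap x + tu.1 *: (w *m (gradmx x)^T)].
  have hk : 0 < harmonic k :> R by exact: harmonic_gt0.
  have [d d0 dP] := strict_open_mapping (@rowmap_strict_diff x) CG w hk.
  pose t := Num.min (d / 2) (Num.min (tau / 2) (harmonic k)).
  have t0 : 0 < t by rewrite !lt_min hk !divr_gt0.
  have td : t < d.
    by rewrite (@le_lt_trans _ _ (d / 2))// ?ge_min ?lexx// gtr_pMr// invf_lt1// ltr1n.
  have tt : t < tau.
    rewrite (@le_lt_trans _ _ (tau / 2))// ?ge_min ?lexx ?orbT//.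
    by rewrite gtr_pMr// invf_lt1// ltr1n.
  have [|u uw Gu] := dP t; first by rewrite t0 td.
  by exists (t, u); split => //=; rewrite ?t0 ?tt// !ge_min lexx !orbT.
have [tu tuP] := choice H.
have t0 : (fun k => (tu k).1) @ \oo --> (0 : R).
  apply: (@squeeze_cvgr _ _ _ _ (cst 0) harmonic) (cvg_cst _) cvg_harmonic.
  by near=> k; have [/andP[/ltW -> _] ->] := tuP k.
have uw : (fun k => (tu k).2) @ \oo --> w.
  apply/subr_cvg0/norm_cvg0P.
  apply: (@squeeze_cvgr _ _ _ _ (cst 0) harmonic) (cvg_cst _) cvg_harmonic.
  by near=> k; have [_ _ h _] := tuP k; rewrite normr_ge0.
exists (fun k => x + (tu k).1 *: (tu k).2), (fun k => (tu k).1).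
split=> //.
- by move=> k; have [] := tuP k.
- by move=> k; have [] := tuP k.
- rewrite -[X in _ --> X]addr0 -[X in _ --> _ + X](scale0r w).
  by apply: cvgD; [exact: cvg_cst|exact: cvgZ].
- rewrite [X in X @ _ --> _](_ : _ = (fun k => (tu k).2))//.
  apply/funext => k; rewrite addrC addKr scalerA mulVf ?scale1r//.
  by have [/andP[/gt_eqF -> _]] := tuP k.
Unshelve. all: by end_near. Qed.
End Preimage.

(** * Multipliers of normals to a preimage *)

Section NormalsOfPreimage.
Context {R : realType} {n p : nat}.
Context (g : 'I_p -> 'rV[R]_n -> R) (S : set 'rV[R]_p).
Context (dg : forall j x, differentiable (g j) x).
Context (cg : forall j, continuous (grad (g j))).

Let M := rowmap g @^-1` S.

Definition feasible_direction (y d : 'rV[R]_p) :=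
  exists2 tau, 0 < tau & forall t, 0 < t < tau -> S (y + t *: d).

Lemma tangent_preimage x (C : 'M[R]_(n, p)) w : gradmx g x *m C = 1%:M ->
  feasible_direction (rowmap g x) (w *m (gradmx g x)^T) ->
  tangent_cone M x w.
Proof.
move=> GC [tau tau0 Sd].
have [xs [t [tP t0 Gxs xsx vw]]] := curve_with_velocity dg cg w GC tau0.
exists xs, t; split => // k; last by have /andP[] := tP k.
by rewrite /M /preimage/= Gxs; exact: Sd.
Qed.

Definition polar_feasible y : set 'rV[R]_p :=
  [set eta | forall d, feasible_direction y d -> dotp eta d <= 0].

(** Moving along the kernel of the Jacobian, in both senses, keeps the value of g
    fixed to first order, so a Frechet normal vanishes there and lies in the row
    space. Every direction d in the image space is the derivative along some w,
    which transfers the polarity. *)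
Lemma frechet_normal_multiplier x (C : 'M[R]_(n, p)) v :
  gradmx g x *m C = 1%:M -> M x -> frechet_normal_cone M x v ->
  exists2 eta, v = eta *m gradmx g x & polar_feasible (rowmap g x) eta.
Proof.
move=> GC Mx vN; set G := gradmx g x in GC *.
(* Applied to w and to - w, this gives equality. *)
have ker w : w *m G^T = 0 -> dotp v w <= 0.
  move=> wG; apply/vN/(tangent_preimage GC); rewrite wG; exists 1 => // t _.
  by rewrite scaler0 addr0.
have : (v <= G)%MS.
  rewrite submxE; apply/eqP/rowP => j; rewrite [RHS]mxE.
  have wG : (col j (cokermx G))^T *m G^T = 0.
    by rewrite -trmx_mul colE mulmxA mulmx_coker mul0mx trmx0.
  have -> : (v *m cokermx G) 0 j = dotp v (col j (cokermx G))^T.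
    by rewrite /dotp trmxK !mxE; apply: eq_bigr => k _; congr (_ * _); rewrite [RHS]mxE.
  apply/eqP; rewrite eq_le ker//= -oppr_le0.
  rewrite [leLHS](_ : _ = dotp v (- (col j (cokermx G))^T)).
    by apply: ker; rewrite mulNmx wG oppr0.
  by rewrite /dotp linearN/= mulmxN [RHS]mxE.
move=> /submxP[eta vE]; exists eta => // d dS.
have dE : d *m C^T *m G^T = d by rewrite -mulmxA -trmx_mul GC trmx1 mulmx1.
have := vN (d *m C^T); rewrite /dotp vE trmx_mul trmxK -mulmxA [G *m _]mulmxA.
rewrite GC mul1mx; apply; apply: (tangent_preimage GC).
by rewrite -/G dE.
Qed.

(** The multipliers at the nearby points are not given with any bound. They are
    recovered from eta_k N_k = v_k C with N_k = Dg(x_k) C, which tends to the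
    identity; hence eta_k converges to v C, and a closed condition Q
    survives. *)
Lemma limiting_normal_multiplier (Q : set 'rV[R]_p) x (C : 'M[R]_(n, p)) v :
  gradmx g x *m C = 1%:M -> closed Q ->
  (forall y, S y -> polar_feasible y `<=` Q) ->
  limiting_normal_cone M x v -> exists2 eta, v = eta *m gradmx g x & Q eta.
Proof.
move=> GC cQ SQ [xs [vs [Mxs xsx vsN vsv]]].
pose N k := gradmx g (xs k) *m C.
have Gk : (fun k => gradmx g (xs k)) @ \oo --> gradmx g x.
  by apply: (@cvg_comp _ _ _ xs (gradmx g)) xsx _; exact: (gradmx_continuous cg).
have N1 : N @ \oo --> (1%:M : 'M[R]_p).
  by rewrite -GC; exact: (mulmx_cvg Gk (cvg_cst C)).
have dN : (fun k => 1%:M - N k) @ \oo --> (0 : 'M[R]_p).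
  by rewrite -(subrr (1%:M : 'M[R]_p)); apply: cvgB => //; exact: cvg_cst.
have ndN : (fun k => `|1%:M - N k|) @ \oo --> (0 : R) by exact/norm_cvg0P.
have near1 : \forall k \near \oo, p%:R * `|1%:M - N k| <= 2^-1.
  have : (fun k => p%:R * `|1%:M - N k|) @ \oo --> (0 : R).
    by rewrite -(mulr0 p%:R); apply: cvgMl_tmp.
  by move=> /cvgr_le; apply; rewrite invr_gt0.
have /choice[eta etaP] k : exists eta, p%:R * `|1%:M - N k| <= 2^-1 ->
    vs k = eta *m gradmx g (xs k) /\ Q eta.
  have [kN|kN] := boolP (p%:R * `|1%:M - N k| <= 2^-1); last by exists 0.
  have /row_freeP[Ck CkP] : row_free (gradmx g (xs k)).
    apply: inj_row_free => eta etaG; have := norm_le_mulmx_near1 eta kN.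
    by rewrite mulmxA etaG mul0mx normr0 mulr0 normr_le0 => /eqP.
  have [e vE eP] := frechet_normal_multiplier CkP (Mxs k) (vsN k).
  by exists e => _; split=> //; apply: SQ eP; exact: Mxs.
have vsC : (fun k => vs k *m C) @ \oo --> v *m C.
  exact: (mulmx_cvg vsv (cvg_cst C)).
have etav : eta @ \oo --> v *m C.
  have -> : eta = (fun k => vs k *m C + (eta k - vs k *m C)).
    by apply/funext => k; rewrite addrC subrK.
  rewrite -[X in _ --> X]addr0; apply: cvgD => //; apply/norm_cvg0P.
  have ub0 : (fun k => p%:R * (2 * `|vs k *m C|) * `|1%:M - N k|) @ \oo --> (0 : R).
    rewrite -[X in _ --> X](mulr0 (p%:R * (2 * `|v *m C|))); apply: cvgM => //.
    by apply: cvgMl_tmp; apply: cvgMl_tmp; exact: cvg_norm.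
  apply: (squeeze_cvgr _ (cvg_cst 0) ub0); near=> k.
  have kN : p%:R * `|1%:M - N k| <= 2^-1 by near: k.
  have [vE _] := etaP k kN; rewrite normr_ge0/=.
  have -> : vs k *m C = eta k *m N k by rewrite vE -mulmxA.
  rewrite -{1}[eta k]mulmx1 -mulmxBr (le_trans (mx_norm_mul _ _))//.
  by rewrite ler_wpM2r// ler_wpM2l// norm_le_mulmx_near1.
exists (v *m C).
  apply: (@norm_cvg_unique _ _ (vs @ \oo)) => //.
  have : (fun k => eta k *m gradmx g (xs k)) @ \oo --> v *m C *m gradmx g x.
    exact: (mulmx_cvg etav Gk).
  apply: cvg_trans; apply: near_eq_cvg; near=> k.
  have kN : p%:R * `|1%:M - N k| <= 2^-1 by near: k.
  by have [-> _] := etaP k kN.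
apply: (closed_cvg Q cQ _ _ etav); near=> k.
have kN : p%:R * `|1%:M - N k| <= 2^-1 by near: k.
by have [] := etaP k kN.
Unshelve. all: by end_near. Qed.

End NormalsOfPreimage.

(** * Gradients as normals *)

Section FrechetGradient.
Context {R : realType} {n : nat}.

(** A first-order necessary condition read backwards: on M the function c f is
    locally at most its value at x, so its derivative along any tangent
    direction is at most 0. *)
Lemma frechet_normal_grad (M : set 'rV[R]_n) f x c :
  (forall z, differentiable f z) -> {for x, continuous (grad f)} -> f x = 0 ->
  (\forall z \near x, M z -> c * f z <= 0) ->
  frechet_normal_cone M x (c *: grad f x).
Proof.
move=> df cf fx0 Mf w [zs [s [Mzs zsx s0 _ wE]]].
pose u k := (s k)^-1 *: (zs k - x).
rewrite leNgt; apply/negP => vw0; pose v := c *: grad f x.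
have dvu : (fun k => dotp v (u k)) @ \oo --> dotp v w.
  have uT : (fun k => (u k)^T) @ \oo --> w^T.
    apply: cvg_mx_coord => i j; rewrite mxE; under eq_fun do rewrite mxE.
    apply: (@cvg_comp _ _ _ u (fun M : 'rV[R]_n => M j i)) wE _.
    exact: coord_continuous.
  have h := mulmx_cvg (cvg_cst (v : 'M[R]_(1, n))) uT.
  exact: (cvg_comp _ _ (h _ _) (@coord_continuous R 1 1 0 0 _)).
(* The tolerance is tuned so that the first-order error, per unit of step,
   stays below half of the value assumed positive. *)
pose K := `|c| * (`|w| + 1) + 1.
have K0 : 0 < K by rewrite ltr_wpDl// mulr_ge0// addr_ge0.
have e0 : 0 < dotp v w / 2 / K by rewrite !divr_gt0.
have [d d0 dP] := strict_diff df cf e0.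
have : \forall k \near \oo, dotp v (u k) <= dotp v w / 2.
  near=> k.
  have /(_ (Mzs k)) Mk : M (zs k) -> c * f (zs k) <= 0 by near: k; exact: (zsx _ Mf).
  have zd : `|zs k - x| < d by near: k; exact: cvgr_distC_lt.
  have xd : `|x - x| < d by rewrite subrr normr0.
  have un : `|u k| <= `|w| + 1.
    near: k; have /cvgr_le : (fun k => `|u k|) @ \oo --> `|w| by exact: cvg_norm.
    by apply; rewrite ltrDl.
  have := dP _ _ zd xd; rewrite fx0 subr0 => h.
  have -> : dotp v (u k) = (s k)^-1 * (c * dotp (grad f x) (zs k - x)).
    rewrite /v /u !dotpE !mulr_sumr; apply: eq_bigr => j _; rewrite !mxE; ring.
  have sk := s0 k.
  rewrite ler_pdivrMl//.
  set D := dotp _ _ in h *.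
  have cD : c * D <= `|c| * (dotp v w / 2 / K * `|zs k - x|).
    have : c * (D - f (zs k)) <= `|c| * `|D - f (zs k)|.
      by rewrite -normrM ler_norm.
    rewrite distrC in h => h'.
    have h2 := ler_wpM2l (normr_ge0 c) h.
    have := le_trans h' h2; rewrite mulrBr => h3; lra.
  apply: (le_trans cD).
  have -> : `|zs k - x| = s k * `|u k|.
    by rewrite /u normrZ ger0_norm ?invr_ge0 ?ltW// mulVKf// gt_eqF.
  rewrite [leLHS](_ : _ = s k * (dotp v w / 2 / K * (`|c| * `|u k|))); last by ring.
  rewrite ler_pM2l// -[leRHS]mulr1 -(mulrA (dotp v w / 2)).
  rewrite ler_pM2l ?divr_gt0// ler_pdivrMl// mulr1.
  by rewrite (@le_trans _ _ (`|c| * (`|w| + 1)))// ?lerDl// ler_wpM2l.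
move=> h; have := @closed_cvg _ _ _ (eventually_filter : ProperFilter \oo) _ (fun y : R => y <= dotp v w / 2)
  (@closed_le _ _) h _ dvu.
by rewrite leNgt ltr_pdivrMr// ltr_pMr// ltr1n.
Unshelve. all: by end_near. Qed.

End FrechetGradient.

Section Generator.
Context {R : realType} {n p : nat}.
Context (g : 'I_p -> 'rV[R]_n -> R) (S : set 'rV[R]_p).
Context (dg : forall j x, differentiable (g j) x).
Context (cg : forall j, continuous (grad (g j))).

(** The points with g-value t d, t > 0, tend to x. At them the j-th gradient is a
    Frechet normal even when it is not one at x. *)
Lemma limiting_normal_grad x (C : 'M[R]_(n, p)) (j : 'I_p)
    (d : 'rV[R]_p) (c : R) :
  gradmx g x *m C = 1%:M -> rowmap g x = 0 -> d 0 j = 0 ->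
  (forall t, 0 < t -> S (t *: d)) ->
  (forall t, 0 < t -> \forall y \near t *: d, S y -> c * y 0 j <= 0) ->
  limiting_normal_cone (rowmap g @^-1` S) x (c *: grad (g j) x).
Proof.
move=> GC gx0 dj Sd Snear.
have [xs [t [tP _ Gxs xsx _]]] :=
  curve_with_velocity dg cg (d *m C^T) GC (ltr01 : (0 : R) < 1).
have {}Gxs k : rowmap g (xs k) = t k *: d.
  by rewrite Gxs gx0 add0r -mulmxA -trmx_mul GC trmx1 mulmx1.
have t0 k : 0 < t k by have /andP[] := tP k.
exists xs, (fun k => c *: grad (g j) (xs k)); split=> // [k|k|].
- by rewrite /preimage/= Gxs; exact: Sd.
- have gE z : g j z = rowmap g z 0 j by rewrite mxE.
  apply: frechet_normal_grad => //; first exact: cg.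
    by rewrite gE Gxs mxE dj mulr0.
  have := Snear _ (t0 k); rewrite -Gxs => h.
  near=> z; rewrite gE => Sz; move: (Sz); near: z.
  exact: (rowmap_continuous dg h).
- by apply: cvgZl_tmp; apply: (@cvg_comp _ _ _ xs (grad (g j))) xsx _; exact: cg.
Unshelve. all: by end_near. Qed.

(** Specialization to a ray along another coordinate k: near such a ray the sign
    of the k-th coordinate is known, and this may decide the sign of the j-th
    coordinate on S. *)
Lemma limiting_normal_grad_partner x (C : 'M[R]_(n, p)) (j k : 'I_p) (s c : R) :
  gradmx g x *m C = 1%:M -> rowmap g x = 0 -> j != k -> s != 0 ->
  (forall t, 0 < t -> S (t *: (s *: delta_mx 0 k))) ->
  (forall y, S y -> 0 < s * y 0 k -> c * y 0 j <= 0) ->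
  limiting_normal_cone (rowmap g @^-1` S) x (c *: grad (g j) x).
Proof.
move=> GC gx0 /negbTE jk s0 Sk Sc.
apply: (limiting_normal_grad (d := s *: delta_mx 0 k) GC) => //.
  by rewrite !mxE jk andbF mulr0.
move=> t t0; set y0 := t *: _.
have y0k : 0 < s * y0 0 k.
  by rewrite !mxE !eqxx mulr1 mulrCA pmulr_rgt0// -expr2 exprn_even_gt0.
have cs : {for y0, continuous (fun y : 'rV[R]_p => s * y 0 k)}.
  by apply: (@cvgMl_tmp R _ (nbhs y0)); exact: coord_continuous.
near=> y => Sy; apply: (Sc _ Sy); near: y.
exact: (cvgr_gt _ cs).
Unshelve. all: by end_near. Qed.

End Generator.

(** * Convex hulls of cones *)

Section Hull.
Context {R : realType} {n : nat}.
Implicit Types (A : set 'rV[R]_n) (u v : 'rV[R]_n).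

Lemma conv_rowE (u v : convex_lmodType 'rV[R]_n) (l : {i01 R}) :
  conv l u v = l%:num *: u + (1 - l%:num) *: v.
Proof. by []. Qed.

Lemma convex_hull_scale A r u : (forall s v, 0 < s -> A v -> A (s *: v)) ->
  0 < r -> convex_hull A u -> convex_hull A (r *: u).
Proof.
move=> cA r0 Au D [cD AD]; apply: (Au [set v | D (r *: v)]); split => [|v Av].
  move=> y z l; rewrite !inE /= => Dy Dz.
  have := cD (r *: y) (r *: z) l; rewrite !inE => /(_ Dy Dz).
  by rewrite !conv_rowE; congr D; apply/rowP => k; rewrite !mxE; ring.
by apply: AD; exact: cA.
Qed.

(** The sum is the midpoint of the doubled vectors, which stay in the hull. *)
Lemma convex_hull_add A u v : (forall s v, 0 < s -> A v -> A (s *: v)) ->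
  convex_hull A u -> convex_hull A v -> convex_hull A (u + v).
Proof.
move=> cA Au Av D [cD AD].
have Du : D (2 *: u) by apply: (convex_hull_scale cA _ Au).
have Dv : D (2 *: v) by apply: (convex_hull_scale cA _ Av).
have h0 : (0 : R) <= 2^-1 by rewrite invr_ge0.
have h1 : (2^-1 : R) <= 1 by lra.
have := cD (2 *: u) (2 *: v) (Itv01 h0 h1); rewrite !inE => /(_ Du Dv).
rewrite conv_rowE; congr D; rewrite /= !scalerA mulVf// mulrBl mulVf//.
by rewrite mul1r (_ : 2 - 1 = 1 :> R) ?scale1r//; ring.
Qed.
End Hull.

(** * Multiplier signs for the five planar cones *)

Section PlanarCones.
Context {R : realType}.
Implicit Types (K : cone_type) (a b e l s t : R).

(** What polarity of (e1, e2) to the feasible directions of the cone at (a, b) says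
    about the two coordinate axes; the sign of s gives the sense of travel. *)
Definition axis_polar K a b e1 e2 :=
  (forall s, (exists2 tau, 0 < tau &
     forall t, 0 < t < tau -> cone K (a + t * s, b)) -> e1 * s <= 0) /\
  (forall s, (exists2 tau, 0 < tau &
     forall t, 0 < t < tau -> cone K (a, b + t * s)) -> e2 * s <= 0).

Lemma axis_polarP K a b e1 e2 : axis_polar K a b e1 e2 ->
  [/\ forall tau, 0 < tau -> (forall t, 0 < t < tau -> cone K (a + t, b)) -> e1 <= 0,
      forall tau, 0 < tau -> (forall t, 0 < t < tau -> cone K (a - t, b)) -> 0 <= e1,
      forall tau, 0 < tau -> (forall t, 0 < t < tau -> cone K (a, b + t)) -> e2 <= 0 &
      forall tau, 0 < tau -> (forall t, 0 < t < tau -> cone K (a, b - t)) -> 0 <= e2].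
Proof.
move=> [P1 P2]; split => tau tau0 h.
- rewrite -(mulr1 e1); apply: P1; exists tau => // t /h; by rewrite mulr1.
- rewrite -oppr_le0 -mulrN1; apply: P1; exists tau => // t /h; by rewrite mulrN1.
- rewrite -(mulr1 e2); apply: P2; exists tau => // t /h; by rewrite mulr1.
- rewrite -oppr_le0 -mulrN1; apply: P2; exists tau => // t /h; by rewrite mulrN1.
Qed.

(** At the origin the coordinate directions that stay in the cone restrict the
    signs of both multipliers; elsewhere on an axis one multiplier vanishes; off
    the axes the cone is a neighbourhood of the point and both vanish. The
    condition of T-stationarity contains all pairs that arise. *)
Lemma axis_polar_sign K a b e1 e2 :
  cone K (a, b) -> axis_polar K a b e1 e2 -> multiplier_sign K (- e1) (- e2).
Proof.
move=> Kab /axis_polarP[e1p e1m e2p e2m]; case: K Kab e1p e1m e2p e2m => /=.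
- move=> [ab0 a0 b0] e1p e1m e2p e2m; rewrite mulrNN.
  have [/andP[a1 b1]|] := boolP ((a == 0) && (b == 0)).
    move: a1 b1 e1p e2p => /eqP-> /eqP-> e1p e2p.
    have h1 : e1 <= 0 by apply: (e1p 1) => // t ?; split; lra.
    have h2 : e2 <= 0 by apply: (e2p 1) => // t ?; split; lra.
    exact: mulr_le0.
  rewrite negb_and; move/eqP: ab0; rewrite mulf_eq0 => /orP[]/eqP z0;
    subst; rewrite eqxx/= ?orbF => z1.
  + have b1 : 0 < b by rewrite lt_def z1.
    have h1 : e2 <= 0 by apply: (e2p 1) => // t ?; split; lra.
    have h2 : 0 <= e2 by apply: (e2m b) => // t ?; split; lra.
    have -> : e2 = 0 by lra.
    by rewrite mulr0.
  + have a1 : 0 < a by rewrite lt_def z1.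
    have h1 : e1 <= 0 by apply: (e1p 1) => // t ?; split; lra.
    have h2 : 0 <= e1 by apply: (e1m a) => // t ?; split; lra.
    have -> : e1 = 0 by lra.
    by rewrite mul0r.
- move=> [a0 ab0] e1p e1m e2p e2m; rewrite mulrNN oppr_le0.
  have [az|an] := eqVneq a 0.
    subst a.
    have h1 : e2 <= 0 by apply: (e2p 1) => // t ?; split; lra.
    have h2 : 0 <= e2 by apply: (e2m 1) => // t ?; split; lra.
    have -> : e2 = 0 by lra.
    by rewrite mulr0.
  have a1 : 0 < a by rewrite lt_def an.
  have b0 : b <= 0 by rewrite -(pmulr_rle0 _ a1).
  have h1 : 0 <= e2 by apply: (e2m 1) => // t ?; split; nra.
  have h2 : e1 <= 0 by apply: (e1p 1) => // t ?; split; nra.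
  have h3 : 0 <= e1 by apply: (e1m a) => // t ?; split; nra.
  have -> : e1 = 0 by lra.
  by rewrite mul0r.
- move=> [ab0 b0] e1p e1m e2p e2m.
  have [bz|bn] := eqVneq b 0.
    subst b; left.
    have h1 : e1 <= 0 by apply: (e1p 1) => // t ?; split; lra.
    have h2 : 0 <= e1 by apply: (e1m 1) => // t ?; split; lra.
    by lra.
  right; have b1 : 0 < b by rewrite lt_def bn.
  move/eqP: ab0; rewrite mulf_eq0 (negbTE bn) orbF => /eqP a0; subst a.
  have : 0 <= e2 by apply: (e2m b) => // t ?; split; lra.
  by lra.
- by [].
- move=> ab e1p e1m e2p e2m; rewrite !oppr_ge0.
  split.
    by apply: (e1p 1) => // t ?; case: ab => h; [left|right]; lra.
  by apply: (e2p 1) => // t ?; case: ab => h; [left|right]; lra.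
Qed.

(** For the switching cone the limiting normals are confined to the axes, although
    the T-multipliers are unrestricted. *)
Lemma switching_axis_polar a b e1 e2 :
  cone Ks (a, b) -> axis_polar Ks a b e1 e2 -> e1 * e2 = 0.
Proof.
move=> /= ab0 /axis_polarP /= [e1p e1m e2p e2m].
move/eqP: ab0; rewrite mulf_eq0 => /orP[]/eqP z0; subst.
- have h1 : e2 <= 0 by apply: (e2p 1) => // t ?; rewrite mul0r.
  have h2 : 0 <= e2 by apply: (e2m 1) => // t ?; rewrite mul0r.
  have -> : e2 = 0 by lra.
  by rewrite mulr0.
- have h1 : e1 <= 0 by apply: (e1p 1) => // t ?; rewrite mulr0.
  have h2 : 0 <= e1 by apply: (e1m 1) => // t ?; rewrite mulr0.
  have -> : e1 = 0 by lra.
  by rewrite mul0r.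
Qed.

(** The number e1 is a normal to the cone, along the first axis, at all points of
    one open half of the second axis; s selects the half. *)
Definition axis_normal1 K e1 := exists s, [/\ s != 0,
  forall t, 0 < t -> cone K (0, t * s) &
  forall a b, 0 < s * b -> cone K (a, b) -> e1 * a <= 0].

Definition axis_normal2 K e2 := exists s, [/\ s != 0,
  forall t, 0 < t -> cone K (t * s, 0) &
  forall a b, 0 < s * a -> cone K (a, b) -> e2 * b <= 0].

(** For all cones except the disjunctive one, the positive half-axis of the partner
    works. The disjunctive cone has no boundary there, and the negative half-axis
    is used. *)
Lemma sign_axis_normal K l1 l2 : multiplier_sign K l1 l2 ->
  axis_normal1 K (- l1) /\ axis_normal2 K (- l2).
Proof.
case: K => /=.
- move=> _; split; exists 1; (split => [|t|a b]; first by rewrite oner_eq0).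
  + by rewrite /= mulr1 mul0r => /ltW.
  + rewrite mul1r /= => b0 [/eqP]; rewrite mulf_eq0 (gt_eqF b0) orbF => /eqP -> _ _.
    by rewrite mulr0.
  + by rewrite /= mulr1 mulr0 => /ltW.
  + rewrite mul1r /= => b0 [/eqP]; rewrite mulf_eq0 (gt_eqF b0) /= => /eqP -> _ _.
    by rewrite mulr0.
- move=> [_ l20]; split; exists 1; (split => [|t|a b]; first by rewrite oner_eq0).
  + by rewrite /= mulr1 mul0r.
  + rewrite mul1r /= => b0 [a0]; rewrite (pmulr_lle0 _ b0) => a0'.
    have -> : a = 0 by lra.
    by rewrite mulr0.
  + by rewrite /= mulr1 mulr0 => /ltW.
  + rewrite mul1r /= => a0 [_]; rewrite (pmulr_rle0 _ a0) => b0.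
    by rewrite mulr_ge0_le0// oppr_ge0.
- move=> _; split; exists 1; (split => [|t|a b]; first by rewrite oner_eq0).
  + by rewrite /= mulr1 mul0r => /ltW.
  + rewrite mul1r /= => b0 [/eqP]; rewrite mulf_eq0 (gt_eqF b0) orbF => /eqP -> _.
    by rewrite mulr0.
  + by rewrite /= mulr1 mulr0.
  + rewrite mul1r /= => b0 [/eqP]; rewrite mulf_eq0 (gt_eqF b0) /= => /eqP -> _.
    by rewrite mulr0.
- move=> _; split; exists 1; (split => [|t|a b]; first by rewrite oner_eq0).
  + by rewrite /= mul0r.
  + rewrite mul1r /= => b0 /eqP; rewrite mulf_eq0 (gt_eqF b0) orbF => /eqP ->.
    by rewrite mulr0.
  + by rewrite /= mulr0.
  + rewrite mul1r /= => b0 /eqP; rewrite mulf_eq0 (gt_eqF b0) /= => /eqP ->.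
    by rewrite mulr0.
- move=> [l10 l20]; split; exists (-1);
    (split => [|t|a b]; first by rewrite oppr_eq0 oner_eq0).
  + by move=> _; left.
  + rewrite mulN1r /= oppr_gt0 ltNge => b0 [a0|/(negP b0)//].
    by rewrite mulNr oppr_le0 mulr_ge0.
  + by move=> _; right.
  + rewrite mulN1r /= oppr_gt0 ltNge => b0 [/(negP b0)//|a0].
    by rewrite mulNr oppr_le0 mulr_ge0.
Qed.

Lemma complementarity_axis_normal e1 e2 :
  axis_normal1 Kc e1 /\ axis_normal2 Kc e2.
Proof.
split.
  have [] := @sign_axis_normal Kc (- e1) 0 _; first by rewrite /= mulr0.
  by rewrite opprK.
have [] := @sign_axis_normal Kc 0 (- e2) _; first by rewrite /= mul0r.
by rewrite opprK.
Qed.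

Lemma closed_nonneg_set (T : topologicalType) (f : T -> R) :
  continuous f -> closed [set x | 0 <= f x].
Proof.
move=> cf; apply: (@closed_comp _ _ f [set y | 0 <= y]) => [x _|]; first exact: cf.
exact: closed_ge.
Qed.

Lemma closed_zero_set (T : topologicalType) (f : T -> R) :
  continuous f -> closed [set x | f x = 0].
Proof.
move=> cf; apply: (@closed_comp _ _ f [set y | y = 0]) => [x _|]; first exact: cf.
exact: closed_eq.
Qed.

Lemma closed_multiplier_sign K (T : topologicalType) (f1 f2 : T -> R) :
  continuous f1 -> continuous f2 ->
  closed [set x | multiplier_sign K (- f1 x) (- f2 x)].
Proof.
move=> c1 c2; have c12 : continuous (fun x => f1 x * f2 x).
  by move=> x; apply: cvgM; [exact: c1|exact: c2].
have cN (f : T -> R) : continuous f -> continuous (fun x => - f x).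
  by move=> cf x; apply: cvgN; exact: cf.
case: K => /=.
- by under eq_fun do rewrite mulrNN; exact: closed_nonneg_set.
- rewrite [X in closed X](_ : _ = [set x | 0 <= f1 x * f2 x] `&` [set x | 0 <= f2 x]).
    by apply: closedI; exact: closed_nonneg_set.
  by apply/seteqP; split => x /=; rewrite mulrNN oppr_le0.
- rewrite [X in closed X](_ : _ = [set x | f1 x = 0] `|` [set x | 0 <= f2 x]).
    by apply: closedU; [exact: closed_zero_set|exact: closed_nonneg_set].
  by apply/seteqP; split => x /=; rewrite oppr_le0 => -[h|h]; [left|right|left|right] => //; lra.
- exact: closedT.
- rewrite [X in closed X](_ : _ = [set x | 0 <= - f1 x] `&` [set x | 0 <= - f2 x])//.
  by apply: closedI; apply: closed_nonneg_set; exact: cN.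
Qed.

End PlanarCones.

(** * The stationarity implications *)

Lemma C2_C1 {R : realType} {n} (f : 'rV[R]_n -> R) : C2 f ->
  (forall x, differentiable f x) /\ continuous (grad f).
Proof. by move=> [df dgf _]; split=> // x; exact: differentiable_continuous. Qed.

Section LimitingCone.
Context {R : realType} {n : nat}.
Implicit Types (M : set 'rV[R]_n) (x v : 'rV[R]_n).

Lemma frechet_sub_limiting M x :
  M x -> frechet_normal_cone M x `<=` limiting_normal_cone M x.
Proof.
by move=> Mx v vN; exists (fun=> x), (fun=> v); split => // ; exact: cvg_cst.
Qed.

Lemma limiting_normal_scale M x r v : 0 < r ->
  limiting_normal_cone M x v -> limiting_normal_cone M x (r *: v).
Proof.
move=> r0 [xs [vs [Mxs xsx vsN vsv]]]; exists xs, (fun k => r *: vs k).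
split=> // [k w /vsN vw|]; last exact: cvgZl_tmp.
by rewrite /dotp -scalemxAl mxE pmulr_rle0.
Qed.

Lemma limiting_normal0 M x : M x -> limiting_normal_cone M x 0.
Proof.
by move=> Mx; apply: frechet_sub_limiting => // w _; rewrite /dotp mul0mx mxE.
Qed.

Lemma convex_hull_limiting_sum M x (I : finType) (F : I -> 'rV[R]_n) :
  M x -> (forall i, convex_hull (limiting_normal_cone M x) (F i)) ->
  convex_hull (limiting_normal_cone M x) (\sum_i F i).
Proof.
move=> Mx FN; apply: (@big_ind _ (convex_hull (limiting_normal_cone M x))) => //.
  by apply: sub_gen_smallest; exact: limiting_normal0.
by move=> u v; apply: convex_hull_add => *; exact: limiting_normal_scale.
Qed.

End LimitingCone.

Section Setting.
Context {R : realType} (K : cone_type) {n m : nat}.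
Context (f : 'rV[R]_n -> R) (F1 F2 : 'I_m -> 'rV[R]_n -> R) (x : 'rV[R]_n).
Context (setting : SNO_setting K f F1 F2 x).

(** The first components come first, then the second ones, in the order in which
    the gradients are listed in SNO-LICQ. *)
Definition pair_family (k : 'I_(m + m)) :=
  match fintype.split k with inl i => F1 i | inr i => F2 i end.

Definition pair_cone : set 'rV[R]_(m + m) :=
  [set y | forall i, cone K (y 0 (lshift m i), y 0 (rshift m i))].

Lemma pair_family_lshift i : pair_family (lshift m i) = F1 i.
Proof. by rewrite /pair_family (unsplitK (inl i : 'I_m + 'I_m)). Qed.

Lemma pair_family_rshift i : pair_family (rshift m i) = F2 i.
Proof. by rewrite /pair_family (unsplitK (inr i : 'I_m + 'I_m)). Qed.

Lemma feasible_setE : feasible_set K F1 F2 = rowmap pair_family @^-1` pair_cone.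
Proof.
apply/seteqP; split => z /= zP i; have := zP i.
  by rewrite !mxE pair_family_lshift pair_family_rshift.
by rewrite !mxE pair_family_lshift pair_family_rshift.
Qed.

Lemma pair_family_differentiable k z : differentiable (pair_family k) z.
Proof.
have [_ dF _ _ _] := setting; rewrite /pair_family.
by case: (fintype.split k) => i; have [/C2_C1[+ _] /C2_C1[+ _]] := dF i.
Qed.

Lemma pair_family_grad_continuous k : continuous (grad (pair_family k)).
Proof.
have [_ dF _ _ _] := setting; rewrite /pair_family.
by case: (fintype.split k) => i; have [/C2_C1[_ +] /C2_C1[_ +]] := dF i.
Qed.

Lemma rowmap_pair_family0 : rowmap pair_family x = 0.
Proof.
have [_ _ _ _ F0] := setting; apply/rowP => k; rewrite !mxE /pair_family.
by case: (fintype.split k) => i; have [] := F0 i.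
Qed.

Lemma SNO_LICQ_right_inverse :
  exists C : 'M[R]_(n, m + m), gradmx pair_family x *m C = 1%:M.
Proof.
have [_ _ _ licq F0] := setting; apply/row_freeP/inj_row_free => eta etaG.
move: licq; rewrite /SNO_LICQ.
rewrite (_ : [seq i <- enum 'I_m | F1 i x == 0] = enum 'I_m); last first.
  by apply/all_filterP/allP => i _; have [-> _] := F0 i.
rewrite (_ : [seq i <- enum 'I_m | F2 i x == 0] = enum 'I_m); last first.
  by apply/all_filterP/allP => i _; have [_ ->] := F0 i.
set s := _ ++ _; have ss : size s == (m + m)%N.
  by rewrite size_cat 2!size_map size_enum_ord.
move=> /(@freeP _ _ _ (Tuple ss)) /(_ (fun k => eta 0 k)) h.
apply/rowP => k; rewrite mxE; apply: h; rewrite -[RHS]etaG mulmx_sum_row.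
apply: eq_bigr => j _; rewrite rowK; congr (_ *: _).
rewrite /= /s nth_cat size_map size_enum_ord -[j in RHS]splitK.
case: splitP => i /= ->.
  rewrite (nth_map i) ?size_enum_ord// nth_ord_enum.
  by rewrite pair_family_lshift.
rewrite addKn (nth_map i) ?size_enum_ord// nth_ord_enum.
by rewrite pair_family_rshift.
Qed.

Lemma mul_gradmx_pair eta : eta *m gradmx pair_family x =
  \sum_i (eta 0 (lshift m i) *: grad (F1 i) x + eta 0 (rshift m i) *: grad (F2 i) x).
Proof.
rewrite mulmx_sum_row big_split_ord/= -big_split/=; apply: eq_bigr => i _.
by rewrite !rowK pair_family_lshift pair_family_rshift.
Qed.

(** In the product cone, the direction along one coordinate only changes the pair
    that contains this coordinate. *)
Lemma polar_feasible_axis y eta i :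
  pair_cone y -> polar_feasible pair_cone y eta ->
  axis_polar K (y 0 (lshift m i)) (y 0 (rshift m i))
    (eta 0 (lshift m i)) (eta 0 (rshift m i)).
Proof.
move=> Sy pol.
have dotp_delta (k : 'I_(m + m)) s : dotp eta (s *: delta_mx 0 k) = eta 0 k * s.
  rewrite dotpE (bigD1 k)//= big1 ?addr0.
    by rewrite !mxE !eqxx mulr1.
  by move=> j /negbTE jk; rewrite !mxE jk andbF !mulr0.
split=> s [tau tau0 h]; rewrite -dotp_delta; apply: pol;
    exists tau => // t /h ht j; have := Sy j; rewrite !mxE !eqxx/=.
  rewrite eq_rlshift eq_lshift !mulr0 addr0.
  have [->|ji] := eqVneq j i; first by rewrite mulr1.
  by rewrite !mulr0 addr0.
rewrite eq_lrshift eq_rshift !mulr0 addr0.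
have [->|ji] := eqVneq j i; first by rewrite mulr1.
by rewrite !mulr0 addr0.
Qed.

Lemma limiting_normal_pair (P : R -> R -> Prop) v :
  (forall i, closed [set eta : 'rV[R]_(m + m) |
      P (eta 0 (lshift m i)) (eta 0 (rshift m i))]) ->
  (forall a b e1 e2, cone K (a, b) -> axis_polar K a b e1 e2 -> P e1 e2) ->
  limiting_normal_cone (feasible_set K F1 F2) x v ->
  exists e1 e2 : 'I_m -> R,
    v = \sum_i (e1 i *: grad (F1 i) x + e2 i *: grad (F2 i) x) /\
    forall i, P (e1 i) (e2 i).
Proof.
move=> cP axP; rewrite feasible_setE => vN.
have [C GC] := SNO_LICQ_right_inverse.
pose Q : set 'rV[R]_(m + m) :=
  \bigcap_i [set eta | P (eta 0 (lshift m i)) (eta 0 (rshift m i))].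
have [||eta vE Qeta] := limiting_normal_multiplier pair_family_differentiable
  pair_family_grad_continuous (Q := Q) GC _ _ vN.
- by apply: closed_bigI => i _; exact: cP.
- move=> y Sy eta pol i _; apply: (axP _ _ _ _ (Sy i)).
  exact: polar_feasible_axis.
- exists (fun i => eta 0 (lshift m i)), (fun i => eta 0 (rshift m i)).
  by rewrite vE mul_gradmx_pair; split => // i; exact: Qeta.
Qed.

Lemma frechet_normal_pair v :
  frechet_normal_cone (feasible_set K F1 F2) x v ->
  exists e1 e2 : 'I_m -> R,
    v = \sum_i (e1 i *: grad (F1 i) x + e2 i *: grad (F2 i) x) /\
    forall i, axis_polar K 0 0 (e1 i) (e2 i).
Proof.
have [_ _ + _ _] := setting; rewrite feasible_setE => Mx vN.
have [C GC] := SNO_LICQ_right_inverse.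
have [eta vE pol] := frechet_normal_multiplier pair_family_differentiable
  pair_family_grad_continuous GC Mx vN.
exists (fun i => eta 0 (lshift m i)), (fun i => eta 0 (rshift m i)).
rewrite vE mul_gradmx_pair; split => // i.
by have := polar_feasible_axis i Mx pol; rewrite rowmap_pair_family0 !mxE.
Qed.

Lemma cone_origin (i : 'I_m) : cone K ((0 : R), (0 : R)).
Proof.
by have [_ _ + _ F0] := setting; move=> /(_ i); have [-> ->] := F0 i.
Qed.

Lemma limiting_normal_grad1 i e : axis_normal1 K e ->
  limiting_normal_cone (feasible_set K F1 F2) x (e *: grad (F1 i) x).
Proof.
move=> [s [s0 Ks Kn]]; have [C GC] := SNO_LICQ_right_inverse.
rewrite feasible_setE -pair_family_lshift.
apply: (limiting_normal_grad_partner pair_family_differentiable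
  pair_family_grad_continuous (k := rshift m i) GC _ _ s0).
- exact: rowmap_pair_family0.
- by rewrite eq_lrshift.
- move=> t t0 j; rewrite !mxE !eqxx/= eq_lrshift eq_rshift !mulr0.
  have [_|_] := eqVneq j i; first by rewrite mulr1; exact: Ks.
  by rewrite !mulr0; exact: cone_origin.
- by move=> y Sy yi; exact: (Kn _ _ yi (Sy i)).
Qed.

Lemma limiting_normal_grad2 i e : axis_normal2 K e ->
  limiting_normal_cone (feasible_set K F1 F2) x (e *: grad (F2 i) x).
Proof.
move=> [s [s0 Ks Kn]]; have [C GC] := SNO_LICQ_right_inverse.
rewrite feasible_setE -pair_family_rshift.
apply: (limiting_normal_grad_partner pair_family_differentiable
  pair_family_grad_continuous (k := lshift m i) GC _ _ s0).
- exact: rowmap_pair_family0.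
- by rewrite eq_rlshift.
- move=> t t0 j; rewrite !mxE !eqxx/= eq_rlshift eq_lshift !mulr0.
  have [_|_] := eqVneq j i; first by rewrite mulr1; exact: Ks.
  by rewrite !mulr0; exact: cone_origin.
- by move=> y Sy yi; exact: (Kn _ _ yi (Sy i)).
Qed.

Lemma clarke_normal_sum (e1 e2 : 'I_m -> R) :
  (forall i, axis_normal1 K (e1 i)) -> (forall i, axis_normal2 K (e2 i)) ->
  clarke_normal_cone (feasible_set K F1 F2) x
    (\sum_i (e1 i *: grad (F1 i) x + e2 i *: grad (F2 i) x)).
Proof.
move=> ax1 ax2; apply: subset_closure; have [_ _ Mx _ _] := setting.
apply: convex_hull_limiting_sum => // i; apply: convex_hull_add.
- by move=> *; exact: limiting_normal_scale.
- by apply: sub_gen_smallest; exact: limiting_normal_grad1.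
- by apply: sub_gen_smallest; exact: limiting_normal_grad2.
Qed.

(** The minus sign is why the multipliers of normals are the opposites of the
    T-multipliers throughout. *)
Lemma stationary_wrtP (N : set 'rV[R]_n -> 'rV[R]_n -> set 'rV[R]_n) M z :
  stationary_wrt N f M z <-> N M z (- grad f z).
Proof.
split; last by move=> h; exists (- grad f z) => //; rewrite subrr.
by move=> [v vN /eqP]; rewrite addr_eq0 => /eqP ->; rewrite opprK.
Qed.

Lemma biactive_all i : i \in biactive F1 F2 x.
Proof. by have [_ _ _ _ /(_ i)[F10 F20]] := setting; rewrite inE F10 F20 !eqxx. Qed.

Lemma T_stationaryP : T_stationary K f F1 F2 x <->
  exists e1 e2 : 'I_m -> R,
    - grad f x = \sum_i (e1 i *: grad (F1 i) x + e2 i *: grad (F2 i) x) /\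
    forall i, multiplier_sign K (- e1 i) (- e2 i).
Proof.
have sumE (l1 l2 : 'I_m -> R) :
    \sum_(i in biactive F1 F2 x) (l1 i *: grad (F1 i) x + l2 i *: grad (F2 i) x)
    = - \sum_i (- l1 i *: grad (F1 i) x + - l2 i *: grad (F2 i) x).
  rewrite -sumrN; apply: eq_big => i; first exact: biactive_all.
  by rewrite opprD !scaleNr !opprK.
split=> [[l1 [l2 [fE lP]]]|[e1 [e2 [fE eP]]]].
  exists (fun i => - l1 i), (fun i => - l2 i); split.
    by rewrite fE sumE opprK.
  by move=> i; rewrite !opprK; apply/lP/biactive_all.
exists (fun i => - e1 i), (fun i => - e2 i); split => [|i _]; last exact: eP.
rewrite sumE -[LHS]opprK fE; congr (- _).
by apply: eq_bigr => i _; rewrite !opprK.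
Qed.

Theorem hatN_stationary_N : hatN_stationary K f F1 F2 x -> N_stationary K f F1 F2 x.
Proof.
move=> /stationary_wrtP h; apply/stationary_wrtP/frechet_sub_limiting => //.
by have [] := setting.
Qed.

Theorem N_stationary_T : N_stationary K f F1 F2 x -> T_stationary K f F1 F2 x.
Proof.
move=> /stationary_wrtP vN; apply/T_stationaryP.
apply: (limiting_normal_pair (P := fun e1 e2 => multiplier_sign K (- e1) (- e2)) _ _ vN).
  by move=> i; apply: closed_multiplier_sign; exact: coord_continuous.
by move=> a b e1 e2; exact: axis_polar_sign.
Qed.

Theorem T_stationary_barN : T_stationary K f F1 F2 x -> barN_stationary K f F1 F2 x.
Proof.
move=> /T_stationaryP[e1 [e2 [fE eP]]]; apply/stationary_wrtP; rewrite fE.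
apply: clarke_normal_sum => i; have := sign_axis_normal (eP i); rewrite !opprK;
  by case.
Qed.

End Setting.

(** * Strictness of the implications *)

Section LinearData.
Context {R : realType} {n : nat}.
Implicit Types c x v : 'rV[R]_n.

Lemma dotp_is_linear c : linear (dotp c).
Proof. by move=> a u v; rewrite /dotp linearP/= mulmxDr -scalemxAr !mxE. Qed.

HB.instance Definition _ c :=
  GRing.isLinear.Build R 'rV[R]_n R _ (dotp c) (dotp_is_linear c).

Lemma dotp_continuous c : continuous (dotp c).
Proof.
rewrite (_ : dotp c = fun x => \sum_j c 0 j * x 0 j); last exact/funext/dotpE.
apply: continuous_big => [|j _ x]; first exact: add_continuous.
apply: (@cvgMl_tmp R _ (nbhs x)); exact: coord_continuous.
Qed.

Lemma dotp_differentiable c x : differentiable (dotp c) x.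
Proof. exact/linear_differentiable/dotp_continuous. Qed.

Lemma grad_dotp c : grad (dotp c) = cst c.
Proof.
apply/funext => x; apply/rowP => j; rewrite mxE.
rewrite deriveE; last exact: dotp_differentiable.
rewrite diff_lin; last exact: dotp_continuous.
rewrite /= dotpE (bigD1 j)//= big1 ?addr0 ?mxE ?eqxx ?mulr1//.
by move=> k /negbTE kj; rewrite mxE kj andbF mulr0.
Qed.

Lemma C2_dotp c : C2 (dotp c).
Proof.
rewrite /C2 grad_dotp; split => [x|x|]; first exact: dotp_differentiable.
  exact: differentiable_cst.
rewrite (_ : (fun x => _) = cst (lin1_mx (0 : 'rV[R]_n -> 'rV[R]_n))).
  exact: cst_continuous.
by apply/funext => x; rewrite /jacobian diff_cst.
Qed.

End LinearData.

Section PlanarExample.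
Context {R : realType}.
Implicit Types (K : cone_type) (c : 'rV[R]_2).

Let e0 : 'rV[R]_2 := delta_mx 0 0.
Let e1 : 'rV[R]_2 := delta_mx 0 1.
Definition axis0 (_ : 'I_1) : 'rV[R]_2 -> R := dotp e0.
Definition axis1 (_ : 'I_1) : 'rV[R]_2 -> R := dotp e1.

Lemma planar_setting K c : SNO_setting K (dotp c) axis0 axis1 0.
Proof.
have d0 (u : 'rV[R]_2) : dotp u 0 = 0 by rewrite linear0.
split; first exact: C2_dotp.
- by move=> i; split; exact: C2_dotp.
- move=> i; rewrite /axis0 /axis1 !d0.
  by case: K => /=; rewrite ?mulr0 ?lexx//; left.
- rewrite /SNO_LICQ !enum_ordSl.
  rewrite (_ : enum 'I_0 = [::]) ?enum_ord0//= /axis0 /axis1 !d0 eqxx/=.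
  rewrite !grad_dotp free_cons seq1_free span_seq1; apply/andP; split.
    apply/negP => /vlineP[k /(congr1 (fun v : 'rV[R]_2 => v 0 0))] /eqP.
    by rewrite !mxE /= mulr0 oner_eq0.
  apply/eqP => /(congr1 (fun v : 'rV[R]_2 => v 0 1)) /eqP.
  by rewrite !mxE/= oner_eq0.
- by move=> i; rewrite /axis0 /axis1 !d0.
Qed.

Lemma planar_sum (a b : 'I_1 -> R) c :
  - grad (dotp c) (0 : 'rV[R]_2) =
     \sum_i (a i *: grad (axis0 i) 0 + b i *: grad (axis1 i) 0) <->
  a 0 = - c 0 0 /\ b 0 = - c 0 1.
Proof.
rewrite big_ord_recl big_ord0 addr0 !grad_dotp /=; split => [cE|[aE bE]].
  split; [have /(congr1 (fun v : 'rV[R]_2 => v 0 0)) := cE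
         |have /(congr1 (fun v : 'rV[R]_2 => v 0 1)) := cE];
    by rewrite !mxE /= ?mulr1 ?mulr0 ?addr0 ?add0r.
apply/rowP => j; rewrite !mxE aE bE.
by case: j => [[|[|//]] jP] /=; rewrite ?mulr1 ?mulr0 ?addr0 ?add0r;
  congr (- c 0 _); apply/val_inj.
Qed.

(** Both directions along the first axis are feasible at 0, so no Frechet normal
    has a component along it. *)
Theorem N_not_hatN : N_stationary Ks (dotp e0) axis0 axis1 0 /\
  ~ hatN_stationary Ks (dotp e0) axis0 axis1 0.
Proof.
have S := planar_setting Ks e0; split.
  apply/stationary_wrtP; have [|ax _] := @sign_axis_normal R Ks 1 0 _ => //.
  have := limiting_normal_grad1 S 0 ax.
  by rewrite !grad_dotp scaleN1r.
move=> /stationary_wrtP /(frechet_normal_pair S)[a [b [/planar_sum[aE _] ax]]].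
have /axis_polarP[_ h _ _] := ax 0.
suff : 0 <= a 0 by rewrite aE !mxE/= oppr_ge0 ler10.
by apply: (h 1) => // t _; rewrite /= mulr0.
Qed.

(** The vector - (1, 1) lies on no axis, hence is not a limiting normal. *)
Theorem T_not_N : T_stationary Ks (dotp (e0 + e1)) axis0 axis1 0 /\
  ~ N_stationary Ks (dotp (e0 + e1)) axis0 axis1 0.
Proof.
have S := planar_setting Ks (e0 + e1); split.
  apply/(T_stationaryP S); exists (fun=> -1), (fun=> -1); split => //.
  by apply/planar_sum; rewrite !mxE /= addr0 add0r.
move=> /stationary_wrtP /(limiting_normal_pair S (P := fun a b => a * b = 0)).
case.
- move=> i; apply: closed_zero_set => eta.
  by apply: (@cvgM _ _ (nbhs eta)); exact: coord_continuous.
- exact: switching_axis_polar.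
- move=> a [b [/planar_sum[aE bE] /(_ 0)/eqP]].
  by rewrite aE bE !mxE/= addr0 add0r mulrNN mulr1 oner_eq0.
Qed.

(** The vector (-1, 1) is the sum of limiting normals along the two axes, but its
    coordinates have opposite signs, and the multipliers are unique here. *)
Theorem barN_not_T : barN_stationary Kc (dotp (e0 - e1)) axis0 axis1 0 /\
  ~ T_stationary Kc (dotp (e0 - e1)) axis0 axis1 0.
Proof.
have S := planar_setting Kc (e0 - e1); split.
  apply/stationary_wrtP.
  have -> := (planar_sum (fun=> -1) (fun=> 1) (e0 - e1)).2.
    apply: (clarke_normal_sum S) => i;
      by have [] := @complementarity_axis_normal R (-1) 1.
  by rewrite !mxE /= subr0 sub0r opprK.
move=> /(T_stationaryP S)[a [b [/planar_sum[aE bE] /(_ 0)]]].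
by rewrite /= aE bE !mxE/= subr0 sub0r !opprK mul1r ler0N1.
Qed.

End PlanarExample.

Theorem proposition9 (R : realType) :
  (forall (K : cone_type) (n m : nat) (f : 'rV[R]_n -> R)
          (F1 F2 : 'I_m -> 'rV[R]_n -> R) (x : 'rV[R]_n),
     SNO_setting K f F1 F2 x ->
     (hatN_stationary K f F1 F2 x -> N_stationary K f F1 F2 x) /\
     (N_stationary K f F1 F2 x -> T_stationary K f F1 F2 x) /\
     (T_stationary K f F1 F2 x -> barN_stationary K f F1 F2 x)) /\
  (exists (K : cone_type) (n m : nat) (f : 'rV[R]_n -> R)
          (F1 F2 : 'I_m -> 'rV[R]_n -> R) (x : 'rV[R]_n),
     SNO_setting K f F1 F2 x /\
     N_stationary K f F1 F2 x /\ ~ hatN_stationary K f F1 F2 x) /\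
  (exists (K : cone_type) (n m : nat) (f : 'rV[R]_n -> R)
          (F1 F2 : 'I_m -> 'rV[R]_n -> R) (x : 'rV[R]_n),
     SNO_setting K f F1 F2 x /\
     T_stationary K f F1 F2 x /\ ~ N_stationary K f F1 F2 x) /\
  (exists (K : cone_type) (n m : nat) (f : 'rV[R]_n -> R)
          (F1 F2 : 'I_m -> 'rV[R]_n -> R) (x : 'rV[R]_n),
     SNO_setting K f F1 F2 x /\
     barN_stationary K f F1 F2 x /\ ~ T_stationary K f F1 F2 x).
Proof.
split.
  move=> K n m f F1 F2 x S; split; first exact: hatN_stationary_N S.
  by split; [exact: N_stationary_T S|exact: T_stationary_barN S].
split; [|split].
- exists Ks, 2%N, 1%N, (dotp (delta_mx 0 0)), axis0, axis1, 0;
  split; [exact: planar_setting|exact: N_not_hatN].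
- exists Ks, 2%N, 1%N, (dotp (delta_mx 0 0 + delta_mx 0 1)), axis0, axis1, 0;
  split; [exact: planar_setting|exact: T_not_N].
- exists Kc, 2%N, 1%N, (dotp (delta_mx 0 0 - delta_mx 0 1)), axis0, axis1, 0;
  split; [exact: planar_setting|exact: barN_not_T].
Qed.
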